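(* Let $d\in\{2,3\}$ and let $m>d$ be an integer. Then $f_{\triangle}(d,m)=dm+\lfloor m/d\rfloor\lfloor d/2\rfloor$.
   Context: All graphs are finite, simple and undirected. A graph is triangle-free if it has no three pairwise adjacent vertices. $\Delta(G)$ is the maximum degree and $\nu(G)$ the matching number of $G$. For positive integers $d,m$, $f_{\triangle}(d,m)$ is the maximum number of edges of a triangle-free graph $G$ with $\Delta(G)\le d$ and $\nu(G)\le m$. *)

(* Defs.v *)
From mathcomp Require Import all_boot.

Set Implicit Arguments.
Unset Strict Implicit.
Unset Printing Implicit Defensive.

Record sgraph := SGraph {
  vertex :> finType;
  adj : rel vertex;
  adj_sym : symmetric adj;
  adj_irrefl : irreflexive adj }.

Definition edges (G : sgraph) : {set {set G}} :=
  [set [set p.1; p.2] | p : G * G & adj p.1 p.2].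

Definition triangle_free (G : sgraph) : Prop :=
  forall x y z : G, ~ [/\ adj x y, adj y z & adj x z].

Definition degree (G : sgraph) (x : G) : nat := #|[set y | adj x y]|.

Definition max_degree (G : sgraph) : nat := \max_(x : G) degree x.

Definition matching (G : sgraph) (M : {set {set G}}) : bool :=
  (M \subset edges G) && trivIset M.

Definition matching_number (G : sgraph) : nat :=
  \max_(M : {set {set G}} | matching M) #|M|.

Definition is_maximum (S : nat -> Prop) (k : nat) : Prop :=
  S k /\ forall j, S j -> j <= k.

Definition edge_counts (d m : nat) (k : nat) : Prop :=
  exists G : sgraph,
    [/\ triangle_free G, max_degree G <= d, matching_number G <= m
      & #|edges G| = k].

(* [f_triangle_eq d m k] is the equation f_triangle(d, m) = k: it asserts both
   that the maximum defining f_triangle(d, m) exists and that it equals k. *)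
Definition f_triangle_eq (d m k : nat) : Prop :=
  is_maximum (edge_counts d m) k.

(* Main.v *)
Require Import Defs.
From mathcomp Require Import all_boot.
From mathcomp Require Import zify.

(** Upper bound: induct on a vertex set S, writing nu S for its matching number.
    If some vertex lies in every maximum matching of S, deleting it loses at most
    d edges and lowers nu S.  Otherwise, by Gallai's lemma, "equal, or not both
    missed by any maximum matching" is an equivalence relation on S containing
    adjacency.  Several classes split S into parts without edges between them;
    a single class forces |S| <= 2 nu S + 1, and then the degree bound (when
    nu S >= d) or Mantel's theorem (when nu S < d) suffices.

    Lower bound: m %/ d copies of a triangle-free graph on 2d+1 vertices with
    d^2+1 edges, and m %% d stars with d leaves. *)

Set Implicit Arguments.
Unset Strict Implicit.
Unset Printing Implicit Defensive.

(** * Counting adjacent pairs *)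

Section Arcs.
Variable G : sgraph.
Implicit Types A B S : {set G}.

(** Ordered pairs are counted, so an edge inside both sets counts twice. Cutting a vertex set in two
    then becomes plain arithmetic, with no sets of edges to split. *)
Definition arcs A B : nat := \sum_(x in A) \sum_(y in B) adj x y.

Lemma arcsC A B : arcs A B = arcs B A.
Proof.
rewrite /arcs exchange_big; apply: eq_bigr => x _; apply: eq_bigr => y _.
by rewrite adj_sym.
Qed.

Lemma arcsUl A B S : [disjoint A & B] -> arcs (A :|: B) S = arcs A S + arcs B S.
Proof. move=> dAB; rewrite /arcs -bigU //.
by apply: eq_bigl => x; rewrite !inE. Qed.

Lemma arcsUU A B : [disjoint A & B] ->
  arcs (A :|: B) (A :|: B) = arcs A A + arcs B B + (arcs A B).*2.
Proof.
move=> dAB; rewrite arcsUl // !(arcsC _ (A :|: B)) !arcsUl // (arcsC B A).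
lia.
Qed.

Lemma arcs1l x B : arcs [set x] B = \sum_(y in B) adj x y.
Proof. by rewrite /arcs big_set1. Qed.

Lemma arcs11 (x y : G) : arcs [set x] [set y] = adj x y.
Proof. by rewrite arcs1l big_set1. Qed.

Lemma arcs_degree A B d : (forall x : G, degree x <= d) -> arcs A B <= d * #|A|.
Proof.
move=> le_d; rewrite mulnC -sum_nat_const; apply: leq_sum => x _.
apply: leq_trans (le_d x); rewrite /degree -sum1dep_card big_mkcond /=.
rewrite [leqRHS]big_mkcond; apply: leq_sum => y _.
by case: (y \in B); case: (adj x y).
Qed.

(** Removing a vertex x drops each pair at x together with its reverse. For d = 3 this parity
    removes the extra unit that the degree bound leaves on an odd number of vertices. *)
Lemma arcs_even S : ~~ odd (arcs S S).
Proof.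
move: {2}#|S| (erefl #|S|) => n; elim: n S => [|n IHn] S cS.
  by rewrite (cards0_eq cS) /arcs big_set0.
have [x xS] : exists x, x \in S by apply/card_gt0P; rewrite cS.
rewrite -(setD1K xS) arcsUU; last by rewrite disjoints1 !inE eqxx.
rewrite arcs11 adj_irrefl !oddD odd_double addbF IHn //.
by move: (cardsD1 x S); rewrite xS cS => -[].
Qed.

Lemma arcs_setT : arcs setT setT = \sum_(x : G) degree x.
Proof.
rewrite /arcs; apply: eq_big => [x|x _]; first by rewrite inE.
rewrite /degree -sum1dep_card [RHS]big_mkcond.
by apply: eq_big => [y|y _]; rewrite ?inE //; case: (adj x y).
Qed.

Lemma mem_edges (x y : G) : adj x y -> [set x; y] \in edges G.
Proof. by move=> xy; apply/imsetP; exists (x, y); rewrite ?inE. Qed.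

Lemma edgesP (A : {set G}) :
  reflect (exists x y, adj x y /\ A = [set x; y]) (A \in edges G).
Proof.
apply: (iffP imsetP) => [[[x y]]|[x [y [xy ->]]]]; rewrite ?inE /=.
  by move=> xy ->; exists x, y.
by exists (x, y); rewrite ?inE.
Qed.

Lemma adj_neq (x y : G) : adj x y -> x != y.
Proof. by apply: contraTneq => ->; rewrite adj_irrefl. Qed.

Lemma card_edge A : A \in edges G -> #|A| = 2.
Proof. by case/edgesP=> x [y [xy ->]]; rewrite cards2 adj_neq. Qed.

(** Adjacent ordered pairs are grouped by the edge they span; each fibre is {(x, y), (y, x)}, of
    size two. *)
Lemma handshake : (#|edges G|).*2 = \sum_(x : G) degree x.
Proof.
rewrite -arcs_setT /arcs pair_big_dep /=.
rewrite (eq_bigl xpredT) => [|p]; last by rewrite !inE.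
transitivity (\sum_(p : G * G | adj p.1 p.2) 1); last first.
  by rewrite big_mkcond; apply: eq_bigr => p _; case: adj.
rewrite (partition_big (fun p => [set p.1; p.2]) (mem (edges G))) /=; last first.
  by move=> p; apply: mem_edges.
rewrite -muln2 -sum_nat_const; apply: eq_bigr => _ /edgesP[x [y [xy ->]]].
have neq_xy := adj_neq xy.
rewrite sum1dep_card -[LHS](_ : #|[set (x, y); (y, x)]| = 2); last first.
  by rewrite cards2 xpair_eqE (negbTE neq_xy).
apply: eq_card => -[a b]; rewrite !inE !xpair_eqE /=.
apply/orP/andP => [[]/andP[/eqP-> /eqP->]|[ab /eqP E]].
- by rewrite xy eqxx.
- by rewrite adj_sym xy setUC eqxx.
have: a \in [set x; y] by rewrite -E !inE eqxx.
have: b \in [set x; y] by rewrite -E !inE eqxx orbT.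
have := adj_neq ab; rewrite !inE.
by move=> nab /orP[]/eqP eb /orP[]/eqP ea; move: nab; rewrite ea eb !eqxx; auto.
Qed.

(* Mantel's bound, [arcs S S] being twice the number of edges inside [S]. *)
Lemma mantel S : triangle_free G -> (arcs S S).*2 <= #|S| ^ 2.
Proof.
move=> tfG; have [n le_n] := ubnP #|S|.
elim: n S le_n => // n IHn S le_n.
have [/existsP[x /existsP[y /and3P[xS yS xy]]]|noe] :=
  boolP [exists x, exists y, [&& x \in S, y \in S & adj x y]]; last first.
  rewrite [arcs S S]big1 // => x xS; rewrite big1 // => y yS.
  case xy: (adj x y) => //; case/negP: noe.
  by apply/existsP; exists x; apply/existsP; exists y; apply/and3P.
have neq_xy := adj_neq xy.
have sS : [set x; y] \subset S by rewrite subUset !sub1set xS.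
pose S' := S :\: [set x; y].
have cS : #|S| = #|S'| + 2.
  by rewrite -(cardsID [set x; y] S) (setIidPr sS) cards2 neq_xy addnC.
have dS : [disjoint S' & [set x; y]] by rewrite -setI_eq0 setIDAC setDIl setDv setI0.
have -> : S = S' :|: [set x; y] by rewrite setUC -{1}(setIidPr sS) setID.
rewrite arcsUU // [in leqRHS]cardsU disjoint_setI0 // cards0 subn0 cards2 neq_xy.
have dxy : [disjoint [set x] & [set y]] by rewrite disjoints1 inE.
have := IHn S' _; rewrite !arcsUU // !arcs11 !adj_irrefl xy => /(_ _).
(* A vertex adjacent to both ends of the deleted edge xy would close a triangle. *)
have : arcs S' [set x; y] <= #|S'|.
  rewrite -sum1_card; apply: leq_sum => z _.
  rewrite big_setU1 ?inE //= big_set1.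
  case zx: (adj z x); case zy: (adj z y) => //.
  by case: (tfG z x y).
have : #|S'| < n by lia.
move=> lt_n le_a /(_ lt_n); nia.
Qed.

End Arcs.

(** * Maximum matchings and Gallai's lemma *)

Section Matchings.
Variable G : sgraph.
Implicit Types (A B S : {set G}) (M N : {set {set G}}) (u v w x y : G).

(** These are the matchings of the subgraph induced by S; keeping S a subset of G lets the induction
    delete vertices without changing the graph. *)
Definition matching_in S M := matching M && (cover M \subset S).

Definition nu S := \max_(M | matching_in S M) #|M|.

Definition maximum S M := matching_in S M && (#|M| == nu S).

Lemma matching_in0 S : matching_in S set0.
Proof.
rewrite /matching_in /matching sub0set /cover big_set0 sub0set andbT.
by apply/trivIsetP => A B; rewrite inE.
Qed.

Lemma maximum_ex S : exists M, maximum S M.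
Proof.
have := bigmax_eq_arg _ (F := fun M => #|M|) (matching_in0 S).
case: arg_maxnP => [|M mM _ eM]; first exact: matching_in0.
by exists M; rewrite /maximum mM /nu eM eqxx.
Qed.

Lemma leq_nu S M : matching_in S M -> #|M| <= nu S.
Proof. exact: leq_bigmax_cond. Qed.

Lemma nu_setT : nu setT = matching_number G.
Proof. by apply: eq_bigl => M; rewrite /matching_in subsetT andbT. Qed.

Lemma card_cover_matching M : matching M -> #|cover M| = (#|M|).*2.
Proof.
case/andP=> sM tM; have /eqP -> : #|cover M| == \sum_(A in M) #|A|.
  by rewrite (leq_card_cover M).
rewrite -muln2 -sum_nat_const; apply: eq_bigr => A AM.
by rewrite card_edge // (subsetP sM).
Qed.

Lemma mem_cover M A x : A \in M -> x \in A -> x \in cover M.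
Proof. by move=> AM xA; apply/bigcupP; exists A. Qed.

Lemma matching_mate M x : matching M -> x \in cover M ->
  exists2 y, adj x y & [set x; y] \in M.
Proof.
case/andP=> sM _ /bigcupP[A AM]; have /edgesP[a [b [ab defA]]] := subsetP sM _ AM.
rewrite defA in AM *; rewrite !inE => /orP[]/eqP->; first by exists b.
by exists a; rewrite ?(adj_sym b) 1?setUC.
Qed.

Lemma matching_add M x y : matching M -> adj x y ->
    x \notin cover M -> y \notin cover M ->
  [/\ matching ([set x; y] |: M), cover ([set x; y] |: M) = [set x; y] :|: cover M
    & #|[set x; y] |: M| = #|M|.+1].
Proof.
case/andP=> sM tM xy xM yM; have cU : cover ([set x; y] |: M) = [set x; y] :|: cover M.
  by rewrite /cover bigcup_setU big_set1.
split=> //.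
  rewrite /matching subUset sub1set mem_edges //= sM /=.
  apply: trivIsetU => //; first exact: trivIset1.
  rewrite cover1 disjoints_subset; apply/subsetP => z.
  by rewrite !inE => /orP[]/eqP->.
rewrite cardsU1; case: (boolP (_ \in M)) => // AM.
by case/negP: xM; apply: mem_cover AM _; rewrite !inE eqxx.
Qed.

Lemma matching_remove M A : matching M -> A \in M ->
  matching (M :\ A) /\ cover (M :\ A) = cover M :\: A.
Proof.
case/andP=> sM tM AM; split; last exact: coverD1.
by rewrite /matching (subset_trans (subsetDl _ _) sM) trivIsetD.
Qed.

Lemma maximum_adj S M u v : maximum S M -> u \in S -> v \in S -> adj u v ->
  (u \in cover M) || (v \in cover M).
Proof.
case/andP=> /andP[mM sM] /eqP cM uS vS uv; apply: contraT; rewrite negb_or.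
case/andP=> uM vM; have [mM' cM' szM'] := matching_add mM uv uM vM.
have := @leq_nu S ([set u; v] |: M); rewrite szM' cM ltnn => -> //.
by rewrite /matching_in mM' cM' !subUset !sub1set uS vS sM.
Qed.

(** No maximum matching misses both vertices. [linked S u u] fails once u is missed by some maximum
    matching, so equality is added separately where an equivalence is wanted. *)
Definition linked S u v :=
  [forall M, maximum S M ==> (u \in cover M) || (v \in cover M)].

Lemma linkedP S u v : reflect
  (forall M, maximum S M -> u \notin cover M -> v \in cover M) (linked S u v).
Proof.
apply: (iffP forallP) => [l M mM uM|l M].
  by have /implyP/(_ mM) := l M; rewrite (negbTE uM).
by apply/implyP => mM; case: (boolP (u \in _)) => //= uM; apply: l.
Qed.

Lemma linked_adj S u v : u \in S -> v \in S -> adj u v -> linked S u v.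
Proof.
move=> uS vS uv; apply/linkedP => M mM uM.
by have:= maximum_adj mM uS vS uv; rewrite (negbTE uM).
Qed.

(* Gallai's lemma.  If M misses u and v, choose among the maximum matchings
   missing w one, N, that shares the most edges with M.  N covers u and v, so
   M covers some x <> w that N misses; exchanging the N-edge at the M-mate y of
   x for xy brings N closer to M. *)
Lemma linked_trans S u v w : u != v ->
    (exists2 N, maximum S N & w \notin cover N) ->
  linked S u w -> linked S w v -> linked S u v.
Proof.
move=> neq_uv [N0 mN0 wN0] /linkedP luw /linkedP lwv.
apply/linkedP => M mM uM; apply: contraT => vM.
pose P N := maximum S N && (w \notin cover N).
have PN0 : P N0 by apply/andP.
case: (arg_maxnP (fun N => #|M :&: N|) PN0) => N /andP[mN wN] maxN.
have vN : v \in cover N by apply: lwv mN wN.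
have uN : u \in cover N by apply: contraT => /(luw N mN); rewrite (negbTE wN).
have /andP[/andP[mtM sM] /eqP szM] := mM.
have /andP[/andP[mtN sN] /eqP szN] := mN.
(* The covers of M and N have equal size, and N covers u and v while M does not. Hence M covers at
   least two vertices that N misses, one of them different from w. *)
have [x /and3P[xM xN neq_xw]] :
    exists x, [&& x \in cover M, x \notin cover N & x != w].
  have cDN : #|cover N :\: cover M| >= 2.
    suff: #|[set u; v]| <= #|cover N :\: cover M| by rewrite cards2 neq_uv.
    by rewrite subset_leq_card // subUset !sub1set !inE uM vM uN vN.
  have : 0 < #|(cover M :\: cover N) :\ w|.
    have eqD : #|cover M :\: cover N| = #|cover N :\: cover M|.
      apply: (@addnI #|cover M :&: cover N|); rewrite cardsID setIC cardsID.
      by rewrite !card_cover_matching // szM szN.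
    by move: cDN; rewrite -eqD (cardsD1 w); case: (w \in _) => // /ltnW.
  by case/card_gt0P=> x; rewrite !inE => /and3P[? ? ?]; exists x; apply/and3P.
have [y xy xyM] := matching_mate mtM xM.
have [xS yS] : x \in S /\ y \in S.
  by split; apply: (subsetP sM); apply: mem_cover xyM _; rewrite !inE eqxx ?orbT.
have yN : y \in cover N by have:= maximum_adj mN xS yS xy; rewrite (negbTE xN).
set B := pblock N y; have BN : B \in N by apply: pblock_mem.
have yB : y \in B by rewrite mem_pblock.
(* Both B and xy contain y, so B in M would force B = xy, although N misses x. Removing B therefore
   costs no edge shared with M. *)
have BM : B \notin M.
  apply/negP => BM; have /andP[_ tM] := mtM.
  have defB: B = [set x; y].
    rewrite -(def_pblock tM BM yB) (def_pblock tM xyM) // !inE eqxx orbT //.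
  by case/negP: xN; apply: mem_cover BN _; rewrite defB !inE eqxx.
have [mtN1 cN1] := matching_remove mtN BN.
have xN1 : x \notin cover (N :\ B) by rewrite cN1 inE (negbTE xN) andbF.
have yN1 : y \notin cover (N :\ B) by rewrite cN1 inE yB.
have [mtN' cN' szN'] := matching_add mtN1 xy xN1 yN1.
set N' := _ |: _ in mtN' cN' szN'.
have szNN' : #|N'| = #|N| by rewrite szN' (cardsD1 B N) BN.
have PN' : P N'.
  rewrite /P /maximum /matching_in mtN' szNN' szN eqxx cN' cN1.
  rewrite !subUset !sub1set xS yS (subset_trans (subsetDl _ _) sN) /=.
  (* The new edge xy avoids w: x was chosen so, and y is covered by N. *)
  rewrite !inE (negbTE wN) andbF orbF negb_or eq_sym neq_xw /=.
  by apply: contraNneq wN => ->.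
have leN : #|M :&: N'| <= #|M :&: N| := maxN _ PN'.
move: leN; rewrite leqNgt => /negP[]; apply: proper_card.
apply/properP; split.
  apply/subsetP => A; rewrite !inE => /andP[AM AN]; rewrite AM AN /= andbT.
  by apply/orP; right; apply: contraNneq BM => <-.
exists [set x; y]; first by rewrite !inE xyM eqxx.
rewrite inE xyM /=; apply: contra xN => xyN.
by apply: mem_cover xyN _; rewrite !inE eqxx.
Qed.

Lemma nuU A B : [disjoint A & B] -> nu A + nu B <= nu (A :|: B).
Proof.
move=> dAB; have [M /andP[/andP[mM sM] /eqP <-]] := maximum_ex A.
have [N /andP[/andP[mN sN] /eqP <-]] := maximum_ex B.
have dMN : [disjoint cover M & cover N].
  exact: disjointWl sM (disjointWr sN dAB).
have /andP[sME tM] := mM; have /andP[sNE tN] := mN.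
have mMN : matching (M :|: N) by rewrite /matching subUset sME sNE trivIsetU.
have cMN : cover (M :|: N) = cover M :|: cover N by rewrite /cover bigcup_setU.
have <- : #|M :|: N| = #|M| + #|N|.
  apply: double_inj; rewrite doubleD -!card_cover_matching // cMN.
  by rewrite cardsU disjoint_setI0 // cards0 subn0.
by apply: leq_nu; rewrite /matching_in mMN cMN setUSS.
Qed.

(** A matching of S without v that reached size [nu S] would be a maximum matching of S missing
    v. *)
Lemma nu_essential S v : (forall M, maximum S M -> v \in cover M) ->
  nu (S :\ v) < nu S.
Proof.
move=> ess; have [M /andP[/andP[mM]]] := maximum_ex (S :\ v).
rewrite subsetD1 => /andP[sM vM] /eqP <-.
have mSM : matching_in S M by rewrite /matching_in mM.
rewrite ltn_neqAle leq_nu // andbT; apply: contra vM => szM.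
by apply: ess; rewrite /maximum mSM.
Qed.

End Matchings.

(** * The upper bound *)

(** The claimed value when d is 2 or 3, where [d %/ 2] is 1. *)
Definition edge_bound d n := d * n + n %/ d.

Lemma edge_boundD d a b : d = 2 \/ d = 3 ->
  edge_bound d a + edge_bound d b <= edge_bound d (a + b).
Proof. by rewrite /edge_bound => -[->|->]; lia. Qed.

Lemma edge_boundS d a b : d = 2 \/ d = 3 -> a < b ->
  edge_bound d a + d <= edge_bound d b.
Proof. by rewrite /edge_bound => -[->|->]; lia. Qed.

Lemma leq_edge_bound d a b : d = 2 \/ d = 3 -> a <= b ->
  edge_bound d a <= edge_bound d b.
Proof. by rewrite /edge_bound => -[->|->]; lia. Qed.

Lemma arcs_leq_factor_critical (G : sgraph) (S : {set G}) d k :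
    triangle_free G -> (forall x : G, degree x <= d) -> d = 2 \/ d = 3 ->
  #|S| <= k.*2.+1 -> arcs S S <= (edge_bound d k).*2.
Proof.
move=> tfG degG hd szS.
have := arcs_even S; have := mantel S tfG; have := arcs_degree S S degG.
move: #|S| (arcs S S) szS => n a; rewrite /edge_bound => le_n le_a le_aa even_a.
have [lt_kd|le_dk] := ltnP k d.
  (* Mantel gives a <= 2k(k+1), which is at most 2dk because k < d. *)
  have {}le_aa : a.*2 <= k.*2.+1 ^ 2 by apply: leq_trans le_aa _; rewrite leq_exp2r.
  by rewrite divn_small // addn0; nia.
(* The degree bound gives a <= 2dk + d. As a is even and d is 2 or 3, a <= 2dk + 2, and the quotient
   [k %/ d] pays for the last 2. *)
have : 0 < k %/ d by rewrite divn_gt0 //; case: hd => ->.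
by case: hd le_a le_dk => -> le_a _; lia.
Qed.

Lemma arcs_leq_nu (G : sgraph) d (S : {set G}) :
    triangle_free G -> (forall x : G, degree x <= d) -> d = 2 \/ d = 3 ->
  arcs S S <= (edge_bound d (nu S)).*2.
Proof.
move=> tfG degG hd; have [n le_n] := ubnP #|S|.
elim: n S le_n => // n IHn S le_n.
have [/exists_inP[v vS /forall_inP ess]|] :=
  boolP [exists v in S, [forall (M | maximum S M), v \in cover M]].
  have dv : [disjoint [set v] & S :\ v] by rewrite disjoints1 !inE eqxx.
  rewrite -{1 2}(setD1K vS) arcsUU // arcs11 adj_irrefl.
  have deg_v := arcs_degree [set v] (S :\ v) degG; rewrite cards1 in deg_v.
  have lt_n : #|S :\ v| < n by move: le_n; rewrite (cardsD1 v) vS.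
  have := edge_boundS hd (nu_essential ess); have := IHn _ lt_n.
  move: (edge_bound d (nu S)) (edge_bound d (nu (S :\ v))) deg_v.
  move: (arcs _ _) (arcs (S :\ v) _) => a b c e; clear; lia.
rewrite negb_exists_in => /forall_inP missed.
have {}missed w : w \in S -> exists2 N, maximum S N & w \notin cover N.
  by move/missed; rewrite negb_forall_in => /exists_inP.
have [/forall_inP all_linked|] :=
  boolP [forall u in S, forall v in S, (u == v) || linked S u v].
  (* With a single class, a maximum matching M misses at most one vertex of S, since two missed
     vertices would not be linked. *)
  have [M mM] := maximum_ex S; have /andP[/andP[mtM sM] /eqP <-] := mM.
  apply: arcs_leq_factor_critical => //.
  rewrite -card_cover_matching // -(cardsID (cover M) S) (setIidPr sM) -addn1.
  rewrite leq_add2l; apply/card_le1_eqP => u v; rewrite !inE.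
  case/andP=> uM uS /andP[vM vS].
  have /forall_inP/(_ v vS)/orP[/eqP //|/linkedP/(_ M mM uM)] := all_linked u uS.
  by rewrite (negbTE vM).
rewrite negb_forall_in => /exists_inP[u uS].
rewrite negb_forall_in => /exists_inP[v vS]; rewrite negb_or => /andP[neq_uv nl_uv].
(* The class of u, a proper nonempty part of S because v lies outside it. *)
pose A := [set w in S | (w == u) || linked S u w].
have sAS : A \subset S by apply/subsetP => w; rewrite inE => /andP[].
have dAB : [disjoint A & S :\: A] by rewrite -setI_eq0 setIDA setDIl setDv set0I.
have defS : A :|: (S :\: A) = S by rewrite -{1}(setIidPr sAS) setID.
have uA : u \in A by rewrite inE uS eqxx.
have vA : v \notin A by rewrite inE vS eq_sym (negbTE neq_uv).
(* Adjacent vertices of S are linked, so by transitivity a neighbour in S of a member of the class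
   belongs to the class. *)
have no_cross : arcs A (S :\: A) = 0.
  rewrite /arcs big1 // => a aA; rewrite big1 // => b; rewrite inE => /andP[bA bS].
  case ab: (adj a b) => //; case/negP: bA; rewrite inE bS /=.
  have aS := subsetP sAS a aA; have lab := linked_adj aS bS ab.
  have [//|neq_bu] := eqVneq b u; move: aA; rewrite inE aS /= => /orP[/eqP <- //|lua].
  by apply: linked_trans lua lab; rewrite 1?eq_sym //; apply: missed.
have ltA : #|A| < n.
  apply: leq_trans (proper_card _) le_n.
  by apply/properP; split=> //; exists v.
have ltB : #|S :\: A| < n.
  apply: leq_trans (proper_card _) le_n.
  by apply/properP; split; [exact: subsetDl | exists u; rewrite // inE uA].
rewrite -{1 2}defS arcsUU // no_cross addn0.
apply: leq_trans (leq_add (IHn _ ltA) (IHn _ ltB)) _.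
rewrite -doubleD leq_double; apply: leq_trans (edge_boundD _ _ hd) _.
by apply: leq_edge_bound => //; rewrite -{2}defS nuU.
Qed.

Lemma card_edges_leq (G : sgraph) d m :
    triangle_free G -> max_degree G <= d -> matching_number G <= m ->
    d = 2 \/ d = 3 ->
  #|edges G| <= edge_bound d m.
Proof.
move=> tfG /bigmax_leqP degG le_m hd; rewrite -leq_double handshake -arcs_setT.
apply: leq_trans (arcs_leq_nu setT tfG (fun x => degG x isT) hd) _.
by rewrite leq_double leq_edge_bound // nu_setT.
Qed.

(** * Extremal graphs *)

Section DisjointUnion.
Variables G H : sgraph.

Definition sum_adj (x y : G + H) : bool :=
  match x, y with
  | inl a, inl b => adj a b
  | inr a, inr b => adj a b
  | _, _ => false
  end.

Lemma sum_adj_sym : symmetric sum_adj.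
Proof. by move=> [a|a] [b|b] //=; rewrite adj_sym. Qed.

Lemma sum_adj_irrefl : irreflexive sum_adj.
Proof. by move=> [a|a] /=; rewrite adj_irrefl. Qed.

Definition sum_graph := SGraph sum_adj_sym sum_adj_irrefl.

Lemma inl_inj : injective (@inl G H). Proof. by move=> x y []. Qed.
Lemma inr_inj : injective (@inr G H). Proof. by move=> x y []. Qed.

Lemma degree_inl (x : G) : degree (inl x : sum_graph) = degree x.
Proof.
rewrite /degree -(card_imset _ inl_inj); apply: eq_card => -[y|y].
  by rewrite mem_imset ?inE //; apply: inl_inj.
by rewrite inE /=; apply/esym/imsetP => -[].
Qed.

Lemma degree_inr (x : H) : degree (inr x : sum_graph) = degree x.
Proof.
rewrite /degree -(card_imset _ inr_inj); apply: eq_card => -[y|y].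
  by rewrite inE /=; apply/esym/imsetP => -[].
by rewrite mem_imset ?inE //; apply: inr_inj.
Qed.

Lemma card_edges_sum : #|edges sum_graph| = #|edges G| + #|edges H|.
Proof.
apply: double_inj; rewrite doubleD !handshake big_sumType /=.
by congr (_ + _); apply: eq_bigr => x _; rewrite ?degree_inl ?degree_inr.
Qed.

Lemma max_degree_sum d :
  max_degree G <= d -> max_degree H <= d -> max_degree sum_graph <= d.
Proof.
move=> /bigmax_leqP dG /bigmax_leqP dH; apply/bigmax_leqP => -[x|x] _.
  by rewrite degree_inl dG.
by rewrite degree_inr dH.
Qed.

Lemma triangle_free_sum :
  triangle_free G -> triangle_free H -> triangle_free sum_graph.
Proof.
move=> tG tH [x|x] [y|y] [z|z] [] //= xy yz xz; first exact: (tG x y z).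
exact: (tH x y z).
Qed.

Lemma matching_preimage (K L : sgraph) (f : K -> L) (M : {set {set L}}) :
    injective f -> (forall x y, adj (f x) (f y) = adj x y) -> matching M ->
  matching [set A : {set K} | f @: A \in M].
Proof.
move=> f_inj f_adj /andP[sM tM]; apply/andP; split.
  apply/subsetP => A; rewrite inE => /(subsetP sM)/edgesP[x [y [xy defA]]].
  have /imsetP[a _ xa] : x \in f @: A by rewrite defA !inE eqxx.
  have /imsetP[b _ yb] : y \in f @: A by rewrite defA !inE eqxx orbT.
  rewrite {}xa {}yb in xy defA; apply/edgesP; exists a, b; rewrite -f_adj; split=> //.
  by apply: (imset_inj f_inj); rewrite defA imsetU !imset_set1.
rewrite -(imset_trivIset _ f_inj); apply: trivIsetS tM.
by apply/subsetP => _ /imsetP[A + ->]; rewrite inE.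
Qed.

(** Every edge of the union lies on one side, so a matching is the union of the images of its two
    preimages, which are matchings. *)
Lemma matching_number_sum :
  matching_number sum_graph <= matching_number G + matching_number H.
Proof.
apply/bigmax_leqP => M mM.
pose MG := [set A : {set G} | (@inl G H) @: A \in M].
pose MH := [set A : {set H} | (@inr G H) @: A \in M].
have mMG : matching MG by apply: (@matching_preimage G sum_graph) => //; apply: inl_inj.
have mMH : matching MH by apply: (@matching_preimage H sum_graph) => //; apply: inr_inj.
apply: leq_trans (leq_add (leq_bigmax_cond _ mMG) (leq_bigmax_cond _ mMH)).
rewrite -(card_imset _ (imset_inj inl_inj)) -(card_imset MH (imset_inj inr_inj)).
apply: leq_trans (leq_card_setU _ _); apply: subset_leq_card.
apply/subsetP => A AM; have /andP[/subsetP/(_ A AM) /edgesP[x [y [xy defA]]] _] := mM.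
rewrite inE; case: x y xy defA => [x|x] [y|y] //= xy defA; apply/orP; [left | right].
  by apply/imsetP; exists [set x; y]; rewrite ?inE imsetU !imset_set1 -?defA.
by apply/imsetP; exists [set x; y]; rewrite ?inE imsetU !imset_set1 -?defA.
Qed.

End DisjointUnion.

Lemma edge_countsD d m n k l :
  edge_counts d m k -> edge_counts d n l -> edge_counts d (m + n) (k + l).
Proof.
move=> [G [tG dG mG <-]] [H [tH dH mH <-]]; exists (sum_graph G H); split.
- exact: triangle_free_sum.
- exact: max_degree_sum.
- exact: leq_trans (matching_number_sum G H) (leq_add mG mH).
- exact: card_edges_sum.
Qed.

(** * Graphs given by edge lists *)

Section ListGraph.
Variables (n : nat) (E : seq (nat * nat)).

(** Stated on natural numbers rather than ordinals so that, for a concrete list, triangle-freeness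
    and degrees are decided by evaluation. *)
Definition list_rel (x y : nat) : bool :=
  (x != y) && (((x, y) \in E) || ((y, x) \in E)).

Definition list_adj (x y : 'I_n) := list_rel x y.

Lemma list_adj_sym : symmetric list_adj.
Proof. by move=> x y; rewrite /list_adj /list_rel eq_sym orbC. Qed.

Lemma list_adj_irrefl : irreflexive list_adj.
Proof. by move=> x; rewrite /list_adj /list_rel eqxx. Qed.

Definition list_graph := SGraph list_adj_sym list_adj_irrefl.

Definition list_degree x := count (list_rel x) (iota 0 n).

Lemma degree_list (x : list_graph) : degree x = list_degree (x : 'I_n).
Proof.
rewrite /degree /list_degree -sum1dep_card -sum1_count.
by rewrite -(big_mkord (list_rel (x : 'I_n)) (fun=> 1)) /index_iota subn0.
Qed.

Lemma edge_counts_list d m k :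
    all (fun x => all (fun y => all (fun z =>
      ~~ [&& list_rel x y, list_rel y z & list_rel x z]) (iota 0 n)) (iota 0 n))
      (iota 0 n) ->
    all (fun x => list_degree x <= d) (iota 0 n) ->
    sumn (map list_degree (iota 0 n)) = k.*2 ->
    matching_number list_graph <= m ->
  edge_counts d m k.
Proof.
have ord_iota (x : 'I_n) : (x : nat) \in iota 0 n.
  by rewrite mem_iota add0n ltn_ord.
move=> tf deg cnt le_m; exists list_graph; split=> //.
- move=> x y z /and3P; apply/negP.
  by have /allP/(_ _ (ord_iota x))/allP/(_ _ (ord_iota y))/allP/(_ _ (ord_iota z)) := tf.
- by apply/bigmax_leqP => x _; rewrite degree_list (allP deg).
apply: double_inj; rewrite handshake -cnt sumnE big_map.
rewrite (eq_bigr _ (fun x _ => degree_list x)).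
by rewrite -(big_mkord xpredT list_degree) /index_iota subn0.
Qed.

End ListGraph.

(** * Building blocks and their copies *)

Lemma matching_number_half (G : sgraph) : (matching_number G).*2 <= #|G|.
Proof.
have [M /andP[/andP[mM _] /eqP]] := maximum_ex [set: G].
by rewrite nu_setT => <-; rewrite -card_cover_matching // max_card.
Qed.

Lemma matching_number_star (G : sgraph) (c : G) :
  (forall x y : G, adj x y -> (x == c) || (y == c)) -> matching_number G <= 1.
Proof.
move=> star; apply/bigmax_leqP => M /andP[/subsetP sM /trivIsetP tM].
have cM A : A \in M -> c \in A.
  by move/sM/edgesP=> [x [y [/star xy ->]]]; rewrite !inE ![c == _]eq_sym.
apply/card_le1_eqP => A B AM BM; apply/eqP; apply: contraT => neqAB.
by have /disjointFr/(_ (cM B BM)) := tM B A BM AM neqAB; rewrite (cM A AM).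
Qed.

Definition star_edges d := [seq (0, i) | i <- iota 1 d].

Lemma matching_number_list_star d :
  matching_number (list_graph d.+1 (star_edges d)) <= 1.
Proof.
apply: (@matching_number_star (list_graph d.+1 (star_edges d)) ord0) => x y.
rewrite /= /list_adj /list_rel => /andP[_ /orP[]] /mapP[i _ [ex _]].
  by rewrite -(inj_eq val_inj) /= ex.
by apply/orP; right; rewrite -(inj_eq val_inj) /= ex.
Qed.

Lemma edge_counts_star d : d = 2 \/ d = 3 -> edge_counts d 1 d.
Proof.
case=> ->.
  by apply: (edge_counts_list (n := 3) (E := star_edges 2)) => //;
     apply: matching_number_list_star.
by apply: (edge_counts_list (n := 4) (E := star_edges 3)) => //;
   apply: matching_number_list_star.
Qed.

Lemma edge_counts_odd d : d = 2 \/ d = 3 -> edge_counts d d (d * d).+1.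
Proof.
case=> ->.
  (* The 5-cycle; five vertices allow at most two disjoint edges. *)
  apply: (edge_counts_list (n := 5)
            (E := [:: (0, 1); (1, 2); (2, 3); (3, 4); (4, 0)])) => //.
  rewrite -ltnS -ltn_double; apply: leq_ltn_trans (matching_number_half _) _.
  by rewrite /= card_ord.
(* A 7-cycle with three chords: every vertex has degree 3 except vertex 4, of degree 2, which gives
   10 edges. *)
apply: (edge_counts_list (n := 7)
          (E := [:: (0, 1); (1, 2); (2, 3); (3, 4); (4, 5); (5, 6); (6, 0);
                    (0, 3); (2, 6); (1, 5)])) => //.
rewrite -ltnS -ltn_double; apply: leq_ltn_trans (matching_number_half _) _.
by rewrite /= card_ord.
Qed.

Lemma edge_countsMn d m k n : edge_counts d m k -> edge_counts d (n * m) (n * k).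
Proof.
move=> mk; elim: n => [|n IHn]; last by rewrite !mulSn; apply: edge_countsD.
(* Zero copies: the graph without vertices. *)
apply: (edge_counts_list (n := 0) (E := [::])) => //.
rewrite -leq_double; apply: leq_trans (matching_number_half _) _.
by rewrite /= card_ord.
Qed.

Theorem theorem6 (d m : nat) (hd : d = 2 \/ d = 3) (hm : d < m) :
  f_triangle_eq d m (d * m + (m %/ d) * (d %/ 2)).
Proof.
have -> : d * m + (m %/ d) * (d %/ 2) = edge_bound d m.
  by rewrite /edge_bound; case: hd => ->; rewrite muln1.
split; last by move=> _ [G [tG dG mG <-]]; apply: card_edges_leq.
(* With m = qd + r, the matching numbers add up to at most qd + r = m and the edges to q(d^2 + 1) +
   rd = dm + q. *)
have := edge_countsD (edge_countsMn (m %/ d) (edge_counts_odd hd))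
                     (edge_countsMn (m %% d) (edge_counts_star hd)).
rewrite muln1 -divn_eq; congr edge_counts.
rewrite /edge_bound {3}(divn_eq m d); lia.
Qed.
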